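(* Let $F(x)=\mathbb{E}(f(x,\xi))$, $x\in\mathbb{R}^d$, in the stochastic setting described in the context, and assume that $F$ is continuously differentiable with $L$-Lipschitz continuous gradient ($L>0$) and bounded from below. Assume that $\mathbb{E}\,\nabla f(x,\xi)=\nabla F(x)$ and $\mathbb{E}\|\nabla f(x,\xi)-\nabla F(x)\|^2\le\sigma^2$ for all $x\in\mathbb{R}^d$. Let $b>0$ and let $(x_n),(p_n)$ be generated, from deterministic $x_0,p_0\in\mathbb{R}^d$, by $$p_{n+1}=p_n+b(\nabla f(x_n,\xi_{n+1})-p_n),\qquad x_{n+1}=x_n-a_{n+1}p_{n+1},\qquad n\ge 0.$$ Let $\alpha>0$ be such that $a_{n+1}\le a_n/\alpha$ for all $n\in\mathbb{N}$, and suppose that $1-\alpha<b\le 1$. Let $\varepsilon>0$ be such that $$\bar a_{\sup}:=\frac{2}{L}\left(\frac34-\frac{(b-(1-\alpha))^2}{2b\alpha}-\frac{1-\alpha}{2b}-\varepsilon\right)$$ is nonnegative. Let $\delta>0$ be such that for all $n\ge 0$, almost surely, $$\delta\le a_{n+1}\le\min\left(\bar a_{\sup},\frac{a_n}{\alpha}\right).$$ Then, for every $n\ge 1$, $$\mathbb{E}[\|\nabla F(x_\tau)\|^2]\le\frac{4}{nb^2}\left(\frac{H_0-\inf F}{\delta\varepsilon}+\|p_0\|^2\right)+\frac{4\bar a_{\sup}}{\delta\varepsilon b^2}\sigma^2,$$ where $H_0=F(x_0)+\frac{1}{2b}\langle a_0,p_0^2\rangle$ and $x_\tau$ is an iterate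 chosen uniformly at random from $\{x_0,\dots,x_{n-1}\}$ (that is, $\tau$ is uniform on $\{0,\dots,n-1\}$ and independent of $(\xi_k)_{k\ge1}$).
   Context: All operations and inequalities between vectors of $\mathbb{R}^d$ are coordinatewise: $xy$, $x/y$, $x^2$, $\min$ are taken coordinate by coordinate, $x\le y$ means that every coordinate of $x$ is at most the corresponding coordinate of $y$, and for a scalar $\lambda$, $x\le\lambda$ (resp. $\lambda\le x$) means that every coordinate of $x$ is at most (resp. at least) $\lambda$. $\langle\cdot,\cdot\rangle$ and $\|\cdot\|$ are the Euclidean inner product and norm. Stochastic setting: $(\Xi,\mathfrak{S})$ is a measurable space, $f:\mathbb{R}^d\times\Xi\to\mathbb{R}$ is measurable, $\xi$ is a $\Xi$-valued random variable, $(\xi_n)_{n\ge1}$ are i.i.d. copies of $\xi$; $f(x,\xi)$ is integrable for every $x$; for each fixed value of $\xi$, $x\mapsto f(x,\xi)$ is differentiable (possibly nonconvex) with gradient in $x$ denoted $\nabla f(x,\xi)$. The step sizes $a_n$ are random vectors of $\mathbb{R}^d$ with positive coordinates which may depend on past iterates and stochastic gradients: $a_0$ is deterministic and $a_{n+1}$ is measurable with respect to $\sigma(\xi_1,\dots,\xi_{n+1})$ for each $n\ge0$. *)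

(* Defs.v *)
(* MathComp / MathComp-Analysis. *)
From HB Require Import structures.
From mathcomp Require Import all_boot all_order all_algebra.
From mathcomp Require Import all_classical all_reals all_analysis.

Set Implicit Arguments.
Unset Strict Implicit.
Unset Printing Implicit Defensive.

Import Order.TTheory GRing.Theory Num.Theory.
Import numFieldNormedType.Exports.

Local Open Scope classical_set_scope.
Local Open Scope ring_scope.

Section Euclidean.
Context {R : realType} {d : nat}.
Implicit Types (u v x : 'rV[R]_d) (c : R).

Definition dotv u v : R := \sum_(i < d) u 0 i * v 0 i.

(* The library norm `|u| on row vectors is the sup norm. *)
Definition enorm u : R := Num.sqrt (dotv u u).

Definition vlt u v : Prop := forall i, u 0 i < v 0 i.
Definition vle u v : Prop := forall i, u 0 i <= v 0 i.
Definition vsqr u : 'rV[R]_d := map_mx (fun t => t ^+ 2) u.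
Definition vmin u v : 'rV[R]_d := map2_mx Num.min u v.

(* Vector of partial derivatives; it represents the differential at points
   where F is differentiable. *)
Definition gradient (F : 'rV[R]_d -> R) x : 'rV[R]_d :=
  \row_(i < d) 'D_(delta_mx 0 i) F x.

End Euclidean.

(* R^d with its Borel sigma-algebra. *)
Definition borel_rV (R : realType) (d : nat) :=
  g_sigma_algebraType (@open 'rV[R]_d).

Section Probability.
Context {R : realType} {dO dX : measure_display}.
Context {Omega : measurableType dO} {Xi : measurableType dX}.
Variable P : probability Omega R.

(* Mutual independence of the whole sequence: product rule over every finite
   set of distinct indices. *)
Definition mutually_independent (X : nat -> Omega -> Xi) : Prop :=
  forall (s : seq nat) (A : nat -> set Xi), uniq s ->
    (forall k, measurable (A k)) ->
    P (\bigcap_(k in [set` s]) (X k @^-1` A k)) =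
    (\prod_(k <- s) P (X k @^-1` A k))%E.

(* sigma(X_0, X_1, X_2, ...) *)
Definition sigma_seq (X : nat -> Omega -> Xi) : set (set Omega) :=
  <<s \bigcup_k preimage_set_system [set: Omega] (X k) measurable >>.

Definition independent_of (tau : Omega -> nat) (G : set (set Omega)) : Prop :=
  forall (B : set nat) (A : set Omega), G A ->
    P (tau @^-1` B `&` A) = (P (tau @^-1` B) * P A)%E.

Definition uniform_below (n : nat) (tau : Omega -> nat) : Prop :=
  forall k, (k < n)%N -> P (tau @^-1` [set k]) = (n%:R^-1)%:E.

End Probability.

Definition step_bound {R : realType} (L b alpha eps : R) : R :=
  2 / L * (3 / 4 - (b - (1 - alpha)) ^+ 2 / (2 * b * alpha)
           - (1 - alpha) / (2 * b) - eps).

(* Main.v *)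
Require Import Defs.
From HB Require Import structures.
From mathcomp Require Import all_boot all_order all_algebra.
From mathcomp Require Import all_classical all_reals all_analysis.
From mathcomp Require Import measurable_realfun.
From mathcomp Require Import ring lra.

Set Implicit Arguments.
Unset Strict Implicit.
Unset Printing Implicit Defensive.

Import Order.TTheory GRing.Theory Num.Theory.
Import numFieldNormedType.Exports.

Local Open Scope classical_set_scope.
Local Open Scope ring_scope.

(** The energy [H k := F (x k) + (2 b)^-1 <a k, (p k)^2>] decreases along almost
    every trajectory, up to the gradient noise
    [e k := grad f (x k, xi (k+1)) - grad F (x k)]:
<<
      H (k+1) + eps delta |p (k+1)|^2 <= H k + abar |e k|^2.
>>
    Indeed the descent lemma bounds [F (x (k+1)) - F (x k)], the recursion on [p]
    expresses the stochastic gradient as [(p (k+1) - (1 - b) p k) / b], and what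
    remains is, coordinate by coordinate, a quadratic inequality in [p k],
    [p (k+1)] and [e k] ([energy_decrease_coord]); no probability enters.
    Summing the inequality bounds the sum of [|p k|^2], hence also, the
    stochastic gradients being combinations of consecutive [p k], the sum of
    their squared norms ([sum_sqr_gradient_le]). The noise appears there without
    any product with a random step, so the possible dependence of [a (k+1)] on
    [xi (k+1)] is harmless.

    Expectations are taken only at this point. The iterate [x k] is measurable
    with respect to [xi 1, ..., xi k] ([adapted_iterates]), hence independent of
    [xi (k+1)] ([past_independent_new]), so that [xi (k+1)] can be integrated out
    with [x k] held fixed ([integral_independent_copy]). The variance hypothesis then
    gives [E |e k|^2 <= sigma^2], and unbiasedness together with
    [(E Z)^2 <= E Z^2] gives [E |grad F (x k)|^2 <= E |grad f (x k, xi (k+1))|^2].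
    Finally the expectation at the independent uniform time [tau] is the average
    of the expectations at the times [k < n] ([integral_uniform_time]).

    That the iterates are random variables at all, and that Tonelli applies to
    functions of [(x k, xi (k+1))], rests on the joint measurability of the
    gradient of [f], a limit of difference quotients ([measurable_gradient]). *)

(** * Smooth functions *)

Lemma enorm_sqr (R : realType) (d : nat) (u : 'rV[R]_d) :
  enorm u ^+ 2 = \sum_(i < d) u 0 i ^+ 2.
Proof.
rewrite /enorm sqr_sqrtr /dotv; first by apply: eq_bigr => i _; rewrite expr2.
by apply: sumr_ge0 => i _; rewrite -expr2 sqr_ge0.
Qed.

Lemma derive_dotv (R : realType) (d : nat) (F : 'rV[R]_d -> R) x v :
  differentiable F x -> 'D_v F x = dotv (gradient F x) v.
Proof.
move=> dF; rewrite deriveE// {1}(row_sum_delta v) linear_sum /dotv.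
by apply: eq_bigr => i _; rewrite linearZ mxE deriveE// mulrC.
Qed.

Lemma is_derive_line (R : realType) (d : nat) (F : 'rV[R]_d -> R) x v (t : R) :
  differentiable F (x + t *: v) ->
  is_derive t 1 (fun s => F (x + s *: v)) (dotv (gradient F (x + t *: v)) v).
Proof.
move=> dF; have E : (fun h : R => h^-1 *:
    (((fun s => F (x + s *: v)) \o shift t) (h *: 1) - F (x + t *: v))) =
    (fun h => h^-1 *: ((F \o shift (x + t *: v)) (h *: v) - F (x + t *: v))).
  apply/funext => h /=; congr (_ *: (F _ - _)).
  by rewrite scalerDl addrCA scaler1.
split; first by rewrite /derivable E; exact: diff_derivable.
by rewrite /derive E -derive_dotv.
Qed.

(** Along the segment from [x] to [x + v], the gap between the two sides is a
    function of the parameter whose derivative is nonpositive by the Lipschitz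
    bound on the gradient. *)
Lemma descent_lemma (R : realType) (d : nat) (F : 'rV[R]_d -> R) (L : R) :
  0 < L -> (forall x, differentiable F x) ->
  (forall x y, enorm (gradient F x - gradient F y) <= L * enorm (x - y)) ->
  forall x v, F (x + v) <= F x + dotv (gradient F x) v + L / 2 * enorm v ^+ 2.
Proof.
move=> L0 dF lipF x v.
pose c := dotv (gradient F x) v; pose q := L / 2 * enorm v ^+ 2.
pose h := (fun t : R => F (x + t *: v)) - c *: (id : R -> R) - q *: (id : R -> R) ^+ 2.
pose h' (t : R) := dotv (gradient F (x + t *: v)) v - c - q * (2 * t).
have dh (t : R) : is_derive t 1 h (h' t).
  have dl := is_derive_line (dF (x + t *: v)).
  apply: is_derive_eq; rewrite /h' !scaler1 /=.
  by rewrite [X in _ - X]/GRing.scale/= expr1 mulrA -[X in _ - _ * X]scaler1.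
have h'0 (t : R) : 0 < t -> h' t <= 0.
  move=> t0; rewrite /h' subr_le0 -(ler_pM2l (mulr_gt0 L0 t0)) /c /q.
  have := lipF (x + t *: v) x; rewrite addrAC subrr add0r.
  set u := gradient F (x + t *: v) - gradient F x => lip.
  have lip2 : enorm u ^+ 2 <= (L * t) ^+ 2 * enorm v ^+ 2.
    have Etv : enorm (t *: v) ^+ 2 = t ^+ 2 * enorm v ^+ 2.
      rewrite !enorm_sqr mulr_sumr; apply: eq_bigr => i _.
      by rewrite mxE exprMn.
    rewrite exprMn -mulrA -Etv -exprMn ler_pXn2r ?nnegrE ?mulr_ge0 ?sqrtr_ge0//.
    exact: ltW.
  have -> : dotv (gradient F (x + t *: v)) v - dotv (gradient F x) v = dotv u v.
    by rewrite /dotv -sumrB; apply: eq_bigr => i _; rewrite !mxE mulrBl.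
  (* Expanding the square of [u - (L * t) *: v] bounds [dotv u v]. *)
  have : 0 <= \sum_(i < d) (u 0 i - (L * t) * v 0 i) ^+ 2.
    by apply: sumr_ge0 => i _; exact: sqr_ge0.
  have -> : \sum_(i < d) (u 0 i - (L * t) * v 0 i) ^+ 2 =
      enorm u ^+ 2 - 2 * (L * t) * dotv u v + (L * t) ^+ 2 * enorm v ^+ 2.
    rewrite !enorm_sqr /dotv !mulr_sumr -sumrB -big_split/=.
    by apply: eq_bigr => i _; ring.
  lra.
have : h 1 <= h 0.
  apply: (@ler0_derive1_nincr _ h 0 1); rewrite ?lexx ?ler01//.
  - move=> t; rewrite in_itv/= => /andP[t0 _].
    by rewrite derive1E; case: (dh t) => _ ->; exact: h'0.
  - by apply: derivable_within_continuous => t _; case: (dh t).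
rewrite /h /= !fctE /= scale1r scale0r addr0 expr1n expr0n /= scaler0 !scaler1.
rewrite /GRing.scale /= /q /c.
lra.
Qed.

(** * Decrease of the energy along a trajectory *)

(** The noise [g - G] is absorbed by [(g - G) p' <= (g - G)^2 + p'^2 / 4], and
    the product [p p'] by completing a square in [p], which the term in [p^2]
    permits because [alpha a' <= a]. What is left is a multiple of [a' p'^2]
    whose coefficient is exactly [- eps] when [a' = step_bound L b alpha eps]. *)
Lemma energy_decrease_coord (R : realType) (L b alpha eps delta : R)
    (a a' p p' g G : R) :
  0 < L -> 0 < b -> 0 < alpha -> 0 < eps -> 0 < delta ->
  delta <= a' -> a' <= step_bound L b alpha eps -> a' <= alpha^-1 * a ->
  p' = p + b * (g - p) ->
  - (G * (a' * p')) + L / 2 * (a' * p') ^+ 2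
    + (2 * b)^-1 * (a' * p' ^+ 2) - (2 * b)^-1 * (a * p ^+ 2) <=
  - (eps * delta) * p' ^+ 2 + step_bound L b alpha eps * (g - G) ^+ 2.
Proof.
move=> L0 b0 al0 eps0 de0 dea' a'A aa' p'E.
set A := step_bound L b alpha eps in a'A *.
have a'0 : 0 < a' := lt_le_trans de0 dea'.
have gE : g = (p' - (1 - b) * p) / b.
  by rewrite p'E; field; rewrite gt_eqF.
have aE : 0 <= a - alpha * a' by rewrite subr_ge0 -ler_pdivlMl.
have AE : 0 <= A - a' by rewrite subr_ge0.
have dE : 0 <= a' - delta by rewrite subr_ge0.
have i2b : 0 <= (2 * b)^-1 by rewrite invr_ge0 mulr_ge0 ?ltW.
have L2 : 0 <= L / 2 by rewrite divr_ge0 ?ltW.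
(* The slack of the inequality is the sum of the six quantities below. *)
have P1 := mulr_ge0 (mulr_ge0 i2b (sqr_ge0 p)) aE.
have P2 := mulr_ge0 (mulr_ge0 (mulr_ge0 L2 (sqr_ge0 p')) AE) (ltW a'0).
have P3 := mulr_ge0 (mulr_ge0 (ltW eps0) (sqr_ge0 p')) dE.
have P4 := mulr_ge0 (sqr_ge0 (g - G)) AE.
have P5 := mulr_ge0 (ltW a'0) (sqr_ge0 ((g - G) - p' / 2)).
have P6 := mulr_ge0 (ltW a'0) (mulr_ge0 (mulr_ge0 (ltW al0) i2b)
  (sqr_ge0 (p - (1 - b) / alpha * p'))).
rewrite -subr_ge0.
suff -> : - (eps * delta) * p' ^+ 2 + A * (g - G) ^+ 2 -
  (- (G * (a' * p')) + L / 2 * (a' * p') ^+ 2 +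
   (2 * b)^-1 * (a' * p' ^+ 2) - (2 * b)^-1 * (a * p ^+ 2)) =
  (2 * b)^-1 * p ^+ 2 * (a - alpha * a') + L / 2 * p' ^+ 2 * (A - a') * a'
  + eps * p' ^+ 2 * (a' - delta) + (g - G) ^+ 2 * (A - a')
  + a' * ((g - G) - p' / 2) ^+ 2
  + a' * (alpha * (2 * b)^-1 * (p - (1 - b) / alpha * p') ^+ 2).
  by do 5 apply: addr_ge0 => //.
rewrite gE /A /step_bound; field.
by rewrite ?gt_eqF.
Qed.

Lemma energy_decrease (R : realType) (d : nat) (F : 'rV[R]_d -> R)
    (L b alpha eps delta : R) (x a a' p p' g : 'rV[R]_d) :
  (forall y, differentiable F y) ->
  (forall y z, enorm (gradient F y - gradient F z) <= L * enorm (y - z)) ->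
  0 < L -> 0 < b -> 0 < alpha -> 0 < eps -> 0 < delta ->
  (forall i, delta <= a' 0 i) ->
  (forall i, a' 0 i <= step_bound L b alpha eps) ->
  (forall i, a' 0 i <= alpha^-1 * a 0 i) ->
  p' = p + b *: (g - p) ->
  F (x - map2_mx *%R a' p') + (2 * b)^-1 * dotv a' (vsqr p') <=
  F x + (2 * b)^-1 * dotv a (vsqr p) - eps * delta * enorm p' ^+ 2
    + step_bound L b alpha eps * enorm (g - gradient F x) ^+ 2.
Proof.
move=> dF lipF L0 b0 al0 eps0 de0 dea' a'A aa' p'E.
have := descent_lemma L0 dF lipF x (- map2_mx *%R a' p').
set G := gradient F x.
have : \sum_(i < d) (- (G 0 i * (a' 0 i * p' 0 i))
      + L / 2 * (a' 0 i * p' 0 i) ^+ 2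
      + (2 * b)^-1 * (a' 0 i * p' 0 i ^+ 2)
      - (2 * b)^-1 * (a 0 i * p 0 i ^+ 2)) <=
    \sum_(i < d) (- (eps * delta) * p' 0 i ^+ 2
      + step_bound L b alpha eps * (g 0 i - G 0 i) ^+ 2).
  apply: ler_sum => i _; apply: energy_decrease_coord => //.
  by rewrite p'E !mxE.
rewrite !big_split/= !sumrN -!mulr_sumr.
have -> : \sum_(i < d) G 0 i * (a' 0 i * p' 0 i) =
    - dotv G (- map2_mx *%R a' p').
  by rewrite -sumrN; apply: eq_bigr => i _; rewrite !mxE mulrN opprK.
have -> : \sum_(i < d) (a' 0 i * p' 0 i) ^+ 2 =
    enorm (- map2_mx *%R a' p') ^+ 2.
  by rewrite enorm_sqr; apply: eq_bigr => i _; rewrite !mxE sqrrN.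
have -> : \sum_(i < d) a' 0 i * p' 0 i ^+ 2 = dotv a' (vsqr p').
  by apply: eq_bigr => i _; rewrite !mxE.
have -> : \sum_(i < d) a 0 i * p 0 i ^+ 2 = dotv a (vsqr p).
  by apply: eq_bigr => i _; rewrite !mxE.
have -> : \sum_(i < d) (g 0 i - G 0 i) ^+ 2 = enorm (g - G) ^+ 2.
  by rewrite enorm_sqr; apply: eq_bigr => i _; rewrite !mxE.
rewrite -enorm_sqr.
lra.
Qed.

(** The bound keeps the noise as a plain sum of squared norms, the
    quantity whose expectation the variance hypothesis controls. *)
Lemma sum_sqr_gradient_le (R : realType) (d : nat) (F : 'rV[R]_d -> R)
    (L b alpha eps delta : R) (x a p g : nat -> 'rV[R]_d) :
  (forall y, differentiable F y) ->
  (forall y z, enorm (gradient F y - gradient F z) <= L * enorm (y - z)) ->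
  has_lbound (range F) ->
  0 < L -> 0 < b -> b <= 1 -> 0 < alpha -> 0 < eps -> 0 < delta ->
  (forall k i, 0 <= a k 0 i) ->
  (forall k i, delta <= a k.+1 0 i) ->
  (forall k i, a k.+1 0 i <= step_bound L b alpha eps) ->
  (forall k i, a k.+1 0 i <= alpha^-1 * a k 0 i) ->
  (forall k, p k.+1 = p k + b *: (g k - p k)) ->
  (forall k, x k.+1 = x k - map2_mx *%R (a k.+1) (p k.+1)) ->
  forall n, \sum_(k < n) enorm (g k) ^+ 2 <=
    4 / b ^+ 2 * ((F (x 0%N) + (2 * b)^-1 * dotv (a 0%N) (vsqr (p 0%N))
                    - inf (range F)) / (delta * eps) + enorm (p 0%N) ^+ 2)
    + 4 * step_bound L b alpha eps / (delta * eps * b ^+ 2)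
      * \sum_(k < n) enorm (g k - gradient F (x k)) ^+ 2.
Proof.
move=> dF lipF lbF L0 b0 b1 al0 eps0 de0 a0 dea aA aa pE xE n.
set A := step_bound L b alpha eps in aA *.
pose H k := F (x k) + (2 * b)^-1 * dotv (a k) (vsqr (p k)).
rewrite -/(H 0%N).
have Hlb k : inf (range F) <= H k.
  apply: (@le_trans _ _ (F (x k))); first by apply: ge_inf => //; exists (x k).
  rewrite lerDl; apply: mulr_ge0; first by rewrite invr_ge0 mulr_ge0 ?ltW.
  by apply: sumr_ge0 => i _; rewrite mxE mulr_ge0 ?sqr_ge0.
have sumH m : eps * delta * \sum_(k < m) enorm (p k.+1) ^+ 2 + H m <=
    H 0%N + A * \sum_(k < m) enorm (g k - gradient F (x k)) ^+ 2.
  elim: m => [|m IH]; first by rewrite !big_ord0 !mulr0 add0r addr0.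
  rewrite !big_ord_recr/=.
  have := @energy_decrease _ _ _ L b alpha eps delta (x m) (a m) (a m.+1)
    (p m) (p m.+1) (g m) dF lipF L0 b0 al0 eps0 de0 (dea m) (aA m) (aa m) (pE m).
  rewrite -xE -/(H m) -/(H m.+1) -/A; lra.
(* The extra term [2 |p m|^2] pays for the next gradient, whose bound involves
   both [p m.+1] and [p m]; this is where the factor 4 comes from. *)
have sumg m : b ^+ 2 * \sum_(k < m) enorm (g k) ^+ 2
    + 2 * enorm (p m) ^+ 2 <=
    4 * \sum_(k < m) enorm (p k.+1) ^+ 2 + 2 * enorm (p 0%N) ^+ 2.
  elim: m => [|m IH]; first by rewrite !big_ord0 !mulr0 !add0r.
  rewrite !big_ord_recr/=.
  suff : b ^+ 2 * enorm (g m) ^+ 2 <=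
      2 * enorm (p m.+1) ^+ 2 + 2 * enorm (p m) ^+ 2 by lra.
  rewrite !enorm_sqr !mulr_sumr -big_split/=; apply: ler_sum => i _.
  rewrite pE !mxE; set s := g m 0 i; set t := p m 0 i.
  have : (1 - b) ^+ 2 * t ^+ 2 <= t ^+ 2.
    by rewrite ler_piMl ?sqr_ge0// exprn_ile1 ?subr_ge0// gerBl ltW.
  have : 0 <= (t + b * (s - t) + (1 - b) * t) ^+ 2 by exact: sqr_ge0.
  lra.
have := sumH n; have := sumg n; have := Hlb n.
have : 0 <= enorm (p n) ^+ 2 by exact: sqr_ge0.
have : 0 <= enorm (p 0%N) ^+ 2 by exact: sqr_ge0.
set Sp := \sum_(k < n) enorm (p k.+1) ^+ 2.
set Sg := \sum_(k < n) enorm (g k) ^+ 2.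
set Se := \sum_(k < n) _.
set p0 := enorm (p 0%N) ^+ 2; set pn := enorm (p n) ^+ 2.
move=> p00 pn0 Hn gn en.
have ed0 : 0 < delta * eps by rewrite mulr_gt0.
have b20 : 0 < b ^+ 2 by rewrite exprn_gt0.
have -> : 4 / b ^+ 2 * ((H 0%N - inf (range F)) / (delta * eps) + p0) +
   4 * A / (delta * eps * b ^+ 2) * Se =
   (4 * ((H 0%N - inf (range F) + A * Se) / (delta * eps)) + 4 * p0) / b ^+ 2.
  by field; rewrite !gt_eqF.
rewrite ler_pdivlMr// mulrC.
suff : Sp <= (H 0%N - inf (range F) + A * Se) / (delta * eps) by lra.
rewrite ler_pdivlMr//; lra.
Qed.

(** * Measurability on the Euclidean space and of the gradient *)

(** Every open set is a countable union of cubes with rational centre and side,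
    and the preimage of a cube is a finite intersection of preimages of
    intervals by the coordinates. *)
Lemma measurable_to_borel_rV (R : realType) (d : nat) dT
    (T : measurableType dT) (h : T -> 'rV[R]_d) :
  (forall i, measurable_fun [set: T] (fun t => h t 0 i)) ->
  measurable_fun [set: T] (h : T -> borel_rV R d).
Proof.
move=> mh; apply: (@measurability _ _ T (borel_rV R d) setT h (@open 'rV[R]_d) erefl).
move=> _ [U oU <-]; rewrite setTI.
pose cube (c : 'rV[rat]_d * nat) : set 'rV[R]_d :=
  [set u | forall i, `|u 0 i - ratr (c.1 0 i)| < (c.2.+1%:R^-1 : R)].
have -> : h @^-1` U =
    \bigcup_(c in [set c | cube c `<=` U]) h @^-1` cube c.
  apply/seteqP; split => [t /= Ut|t [c /= cU ct]]; last exact: cU.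
  have /nbhs_ballP[_/posnumP[e] eU] : nbhs (h t) U by exact: open_nbhs_nbhs.
  have e20 : 0 < e%:num / 2 by rewrite divr_gt0.
  have [m _ me] := near_infty_natSinv_lt (PosNum e20).
  have {me} := me m (leqnn _); rewrite /= => me.
  have m0 : 0 < (m.+1%:R^-1 : R) by rewrite invr_gt0.
  have q_ex i : {q : rat | `|h t 0 i - ratr q| < m.+1%:R^-1}.
    apply: cid; have : h t 0 i - m.+1%:R^-1 < h t 0 i + m.+1%:R^-1.
      by rewrite ltrBlDr -addrA ltrDl addr_gt0.
    move=> /rat_in_itvoo[q]; rewrite in_itv/= => /andP[q1 q2].
    by exists q; rewrite ltr_distl ltrBlDr q2 -ltrBlDr q1.
  exists (\row_i projT1 (q_ex i), m) => /=.
    move=> u uc; apply: eU; split => // i j; rewrite ord1 /ball/=.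
    have := uc j; rewrite mxE /= distrC => uq.
    rewrite -(subrKA (ratr (projT1 (q_ex j)))).
    rewrite (le_lt_trans (ler_normD _ _))// (splitr e%:num).
    by rewrite ltrD ?(lt_trans (projT2 (q_ex j)))// (lt_trans uq).
  by move=> i; rewrite mxE /=; exact: (projT2 (q_ex i)).
rewrite bigcup_mkcond; apply: countable_bigcupT_measurable => [|c].
  exact: countableP.
case: ifPn => // _.
have -> : h @^-1` cube c = \bigcap_(i in [set: 'I_d])
    ((fun t => h t 0 i) @^-1`
      `](ratr (c.1 0 i) - c.2.+1%:R^-1), (ratr (c.1 0 i) + c.2.+1%:R^-1)[).
  apply/seteqP; split => t /= ht i => [_|].
      by have := ht i; rewrite ltr_distl /= in_itv.
  by have := ht i I; rewrite ltr_distl /= in_itv.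
apply: fin_bigcap_measurable => // i _.
by rewrite -[X in measurable X]setTI; apply: mh.
Qed.

Lemma continuous_measurable_borel_rV (R : realType) (d : nat)
    (g : 'rV[R]_d -> R) :
  continuous g -> measurable_fun [set: borel_rV R d] (g : borel_rV R d -> R).
Proof.
move=> /continuousP cg; apply: (measurability _ (RGenOpens.measurableE R)).
move=> _ [_ [x [y ->]] <-]; rewrite setTI; apply: sub_sigma_algebra.
by apply: cg; exact: interval_open.
Qed.

(** Each partial derivative is the pointwise limit of the difference quotients
    with increments [1 / (n + 1)]. *)
Lemma measurable_gradient (R : realType) (d : nat) dX (Xi : measurableType dX)
    (f : 'rV[R]_d -> Xi -> R) :
  measurable_fun [set: borel_rV R d * Xi]
    (fun z : borel_rV R d * Xi => f z.1 z.2) ->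
  (forall z x, differentiable (f^~ z) x) ->
  forall i, measurable_fun [set: borel_rV R d * Xi]
    (fun z : borel_rV R d * Xi => gradient (f^~ z.2) (z.1 : 'rV[R]_d) 0 i).
Proof.
move=> mf df i.
pose q n (z : borel_rV R d * Xi) : R := (n.+1%:R^-1)^-1 *
  (f ((n.+1%:R^-1 : R) *: delta_mx 0 i + (z.1 : 'rV[R]_d)) z.2 - f z.1 z.2).
apply: (@measurable_fun_cvg _ _ _ _ q).
  move=> n; apply: measurable_funM => //; apply: measurable_funB => //.
  apply: (measurableT_comp (f := fun z : borel_rV R d * Xi => f z.1 z.2)
    (g := fun z : borel_rV R d * Xi => ((n.+1%:R^-1 *: delta_mx 0 i + z.1 : borel_rV R d), z.2))) => //.
  apply: measurable_fun_pair; last exact: measurable_snd.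
  apply: measurable_to_borel_rV => j.
  under eq_fun do rewrite mxE.
  apply: measurable_funD => //.
  apply: (measurableT_comp (f := fun u : borel_rV R d => (u : 'rV[R]_d) 0 j)) => //.
  apply: continuous_measurable_borel_rV; exact: coord_continuous.
move=> z _; rewrite mxE.
have : (fun h : R => h^-1 *: (((f^~ z.2) \o shift (z.1 : 'rV[R]_d))
    (h *: delta_mx 0 i) - f z.1 z.2)) @ 0^' -->
    'D_(delta_mx 0 i) (f^~ z.2) (z.1 : 'rV[R]_d).
  exact: diff_derivable.
apply: cvg_comp.
move=> A [e/= e0 eA]; have [N _ Ne] := near_infty_natSinv_lt (PosNum e0).
exists N => // m /Ne /= me; apply: eA => /=.
  by rewrite sub0r normrN ger0_norm.
by rewrite invr_eq0.
Qed.

(** * Independence of the past and the next sample *)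

Section IndependentCopy.
Context {R : realType} {dO d1 d2 : measure_display}.
Context {Omega : measurableType dO} (P : probability Omega R).
Context {T1 : measurableType d1} {T2 : measurableType d2}.
Variables (X : {mfun Omega >-> T1}) (Y Y' : {mfun Omega >-> T2}).
Variable phi : T1 * T2 -> \bar R.
Hypothesis mphi : measurable_fun [set: T1 * T2] phi.
Hypothesis phi_ge0 : forall z, (0 <= phi z)%E.

Lemma measurable_integral_copy :
  measurable_fun [set: T1] (fun t => \int[P]_w' phi (t, Y' w'))%E.
Proof.
rewrite (_ : (fun t => _) =
    (fun t => \int[distribution P Y']_y phi (t, y))%E).
  exact: (measurable_fun_fubini_tonelli_F (m2 := distribution P Y')).
apply/funext => t; rewrite ge0_integral_distribution//.
exact: measurableT_comp.
Qed.

(** The pair [(X, Y)] has the law of [X] times that of [Y'], because the two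
    measures agree on rectangles; Tonelli then integrates out [Y'] first. *)
Lemma integral_independent_copy :
  (forall A B, measurable A -> measurable B ->
    P (X @^-1` A `&` Y @^-1` B) = P (X @^-1` A) * P (Y' @^-1` B))%E ->
  (\int[P]_w phi (X w, Y w) = \int[P]_w \int[P]_w' phi (X w, Y' w'))%E.
Proof.
move=> indXY.
have mXY : measurable_fun [set: Omega] (fun w => (X w, Y w)).
  exact: measurable_fun_pair.
pose XY : {mfun Omega >-> (T1 * T2)%type} := mfun_Sub (mem_set mXY).
rewrite -(@ge0_integral_distribution _ _ _ _ _ P XY phi)//.
rewrite -(@ge0_integral_distribution _ _ _ _ _ P X
    (fun t => \int[P]_w' phi (t, Y' w'))%E); last 2 first.
- exact: measurable_integral_copy.
- by move=> t; exact: integral_ge0.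
rewrite (eq_measure_integral (distribution P X \x distribution P Y')%E); last first.
  by move=> A mA _; apply/esym/product_measure_unique => // B C; exact: indXY.
rewrite fubini_tonelli1//; apply: eq_integral => t _.
rewrite /fubini_F ge0_integral_distribution//.
exact: measurableT_comp.
Qed.

End IndependentCopy.

Section Past.
Context {R : realType} {dO dX : measure_display}.
Context {Omega : measurableType dO} {Xi : measurableType dX}.
Variable P : probability Omega R.
Variable X : nat -> Omega -> Xi.
Hypothesis mX : forall k, measurable_fun [set: Omega] (X k).

Let pre k := preimage_set_system [set: Omega] (X k) measurable.

(** A generating family, so that the sigma-algebra [<<s past n >>] is the
    [g_sigma_preimage] of the first [n] variables by definition. *)
Definition past n : set (set Omega) :=
  \big[setU/set0]_(i < n) preimage_set_system [set: Omega] (X i) measurable.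

Lemma past_measurable n : <<s past n >> `<=` measurable.
Proof.
apply: smallest_sub; first exact: sigma_algebra_measurable.
by rewrite /past -(bigcup_mkord n pre) => A [k _ [B mB <-]]; exact: mX.
Qed.

Lemma past_sigma_seq n : <<s past n >> `<=` sigma_seq X.
Proof.
apply: smallest_sub; first exact: smallest_sigma_algebra.
rewrite /past -(bigcup_mkord n pre) => A [k _ XA]; apply: sub_sigma_algebra.
by exists k.
Qed.

Lemma past_subS n : <<s past n >> `<=` <<s past n.+1 >>.
Proof.
apply: smallest_sub; first exact: smallest_sigma_algebra.
by move=> A pA; apply: sub_sigma_algebra; rewrite /past big_ord_recr; left.
Qed.

Lemma past_measurable_new n :
  measurable_fun [set: g_sigma_algebraType (past n.+1)] (X n).
Proof.
move=> _ B mB; apply: sub_sigma_algebra; rewrite /past big_ord_recr/=.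
by right; exists B.
Qed.

Lemma measurable_fun_pastS n dT (T : measurableType dT) (h : Omega -> T) :
  measurable_fun [set: g_sigma_algebraType (past n)] h ->
  measurable_fun [set: g_sigma_algebraType (past n.+1)] h.
Proof. by move=> mh _ B mB; apply: past_subS; exact: mh. Qed.

Lemma measurable_fun_past n dT (T : measurableType dT) (h : Omega -> T) :
  measurable_fun [set: g_sigma_algebraType (past n)] h ->
  measurable_fun [set: Omega] h.
Proof. by move=> mh _ B mB; apply: (@past_measurable n); exact: mh. Qed.

(** The finite-dimensional cylinders [\bigcap_(k < n) X k @^-1` A k] form a
    pi-system generating the past, and two finite measures that agree on it
    agree everywhere. *)
Lemma past_independent_new n (E : set Omega) (B : set Xi) :
  mutually_independent P X -> <<s past n >> E -> measurable B ->
  P (E `&` X n @^-1` B) = (P E * P (X n @^-1` B))%E.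
Proof.
move=> indX pE mB.
have mXB k C : measurable C -> measurable (X k @^-1` C).
  by move=> mC; rewrite -[X in measurable X]setTI; exact: mX.
pose cyl : set (set Omega) := [set C | exists2 A : nat -> set Xi,
  (forall k, measurable (A k)) & C = \bigcap_(k in [set` iota 0 n]) X k @^-1` A k].
have cyl_sub : <<s past n >> `<=` <<s cyl >>.
  apply: smallest_sub; first exact: smallest_sigma_algebra.
  rewrite /past -(bigcup_mkord n pre) => A [k kn [C mC <-]].
  apply: sub_sigma_algebra.
  exists (fun j => if j == k then C else setT).
    by move=> j; case: ifP.
  rewrite setTI; apply/seteqP; split => w.
    by move=> /= XC j _; case: eqP => // ->.
  move=> /(_ k) /=; rewrite eqxx mem_iota add0n; exact.
have cyl_meas : cyl `<=` measurable.
  move=> _ [A mA ->]; apply: fin_bigcap_measurable => // k _; exact: mXB.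
pose r := fine (P (X n @^-1` B)).
have r0 : 0 <= r by rewrite fine_ge0.
pose m1 : {measure set Omega -> \bar R} := mrestr P (mXB n B mB).
pose m2 : {measure set Omega -> \bar R} := mscale (NngNum r0) P.
suff : m1 E = m2 E.
  rewrite /m1 /m2 /= /mrestr /mscale /= => ->.
  by rewrite fineK ?fin_num_measure// 1?muleC//; exact: (mXB n B mB).
apply: (g_sigma_algebra_measure_unique cyl cyl_meas (fun=> setT)) => //.
- by move=> _; exists (fun=> setT) => //; apply/seteqP; split.
- by rewrite bigcup_const.
- move=> _ _ [A mA ->] [A' mA' ->]; exists (fun k => A k `&` A' k).
    by move=> k; exact: measurableI.
  by rewrite -bigcapI.
- move=> _ [A mA ->]; rewrite /m1 /m2 /= /mrestr /mscale /=.
  pose A' k := if k == n then B else A k.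
  have mA' k : measurable (A' k) by rewrite /A'; case: ifP.
  have n_iota : n \notin iota 0 n by rewrite mem_iota ltnn andbF.
  have A'E k : k \in iota 0 n -> A' k = A k.
    by rewrite /A'; case: eqP => // -> /(negP n_iota).
  have := indX (n :: iota 0 n) A'; rewrite /= n_iota iota_uniq => /(_ isT mA').
  have -> : [set` n :: iota 0 n] = n |` [set` iota 0 n].
    apply/seteqP; split => k /=; rewrite in_cons.
      by move=> /orP[/eqP->|]; [left|right].
    by move=> [->|->]; rewrite ?eqxx ?orbT.
  rewrite bigcap_setU1 big_cons.
  have -> : \bigcap_(k in [set` iota 0 n]) X k @^-1` A' k =
      \bigcap_(k in [set` iota 0 n]) X k @^-1` A k.
    by apply: eq_bigcapr => k /= /A'E ->.
  have -> : (\prod_(k <- iota 0 n) P (X k @^-1` A' k) =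
      \prod_(k <- iota 0 n) P (X k @^-1` A k))%E.
    by apply: eq_big_seq => k /A'E ->.
  rewrite -(indX _ _ (iota_uniq 0 n) mA) {1}/A' {1}/A' eqxx setIC => ->.
  by rewrite /r fineK ?fin_num_measure// -(setTI (_ @^-1` _)); exact: mX.
- by move=> _; rewrite /m1 /= /mrestr setTI ltey_eq fin_num_measure// -(setTI (_ @^-1` _)); exact: mX.
- exact: cyl_sub.
Qed.

End Past.

(** * Evaluation at an independent uniform time *)

(** Almost surely [Y (tau w) w] is the sum over [k < n] of [Y k w] times the
    indicator of [tau w = k], and each product factors by independence. *)
Lemma integral_uniform_time (R : realType) (dO : measure_display)
    (Omega : measurableType dO) (P : probability Omega R) (n : nat)
    (tau : {mfun Omega >-> nat}) (Y : nat -> {mfun Omega >-> R}) :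
  (0 < n)%N -> uniform_below P n tau ->
  (forall k w, 0 <= Y k w) ->
  (forall k A B, measurable B ->
    P (tau @^-1` A `&` Y k @^-1` B) = P (tau @^-1` A) * P (Y k @^-1` B))%E ->
  (\int[P]_w (Y (tau w) w)%:E =
   (n%:R^-1)%:E * \sum_(k < n) \int[P]_w (Y k w)%:E)%E.
Proof.
move=> n0 tau_unif Y0 indY.
(* The absolute value makes [phi] nonnegative on the whole product space. *)
pose phi k (z : nat * R) : \bar R := ((z.1 == k)%:R * `|z.2|)%:E.
have mphi k : measurable_fun [set: nat * R] (phi k).
  apply/measurable_EFinP; apply: measurable_funM.
    by apply: (measurableT_comp (f := fun t : nat => (t == k)%:R : R)).
  by apply: measurableT_comp => //; exact: measurable_snd.
have phi0 k z : (0 <= phi k z)%E by rewrite lee_fin mulr_ge0.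
have tauP : {ae P, forall w, (tau w < n)%N}.
  exists (tau @^-1` [set k | (n <= k)%N]); split.
  - by rewrite -[X in measurable X]setTI; exact: measurable_funP.
  - have mtau B : measurable (tau @^-1` B).
      by rewrite -[X in measurable X]setTI; exact: measurable_funP.
    have -> : tau @^-1` [set k | (n <= k)%N] =
        ~` \big[setU/set0]_(k < n) (tau @^-1` [set (k : nat)]).
      rewrite -(bigcup_mkord n (fun k => tau @^-1` [set k])).
      apply/seteqP; split => w /=.
        by move=> ntau [k /= kn]; rewrite /= => E; rewrite -E ltnNge ntau in kn.
      by move=> H; rewrite leqNgt; apply/negP => tn; apply: H; exists (tau w).
    rewrite probability_setC; last exact: bigsetU_measurable.
    rewrite measure_bigsetU_ord//; last first.
      apply/trivIsetP => i j _ _ /eqP ij; apply/seteqP; split => // w /= [E1 E2].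
      by apply: ij; apply: val_inj; rewrite /= -E1 -E2.
    rewrite (eq_bigr (fun=> (n%:R^-1)%:E)); last by move=> k _; exact: tau_unif.
    rewrite sumEFin sumr_const card_ord -[X in (_ - X%:E)%E]mulr_natr.
    by rewrite mulVf ?subee// pnatr_eq0 -lt0n.
  - by move=> w /= /negP; rewrite -leqNgt.
transitivity (\int[P]_w \sum_(k < n) phi k (tau w, Y k w))%E.
  apply: ge0_ae_eq_integral => //.
  - apply/measurable_EFinP => _ B mB; rewrite setTI.
    have -> : (fun w => Y (tau w) w) @^-1` B =
        \bigcup_k (tau @^-1` [set k] `&` Y k @^-1` B).
      apply/seteqP; split => w /=; first by exists (tau w).
      by move=> [k _ [/= -> ]].
    apply: bigcup_measurable => k _; apply: measurableI;
      by rewrite -[X in measurable X]setTI; exact: measurable_funP.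
  - apply: emeasurable_sum => k; apply: measurableT_comp => //.
    exact: measurable_fun_pair.
  - by move=> w _; rewrite lee_fin.
  - by move=> w _; apply: sume_ge0 => k _; exact: phi0.
  - apply: filterS tauP => w tn _.
    rewrite (bigD1 (Ordinal tn))//= big1 ?adde0; last first.
      move=> k /eqP kt; rewrite /phi /= (_ : (tau w == k) = false) ?mul0r//.
      by apply/eqP => E; apply: kt; exact: val_inj.
    by rewrite /phi /= eqxx mul1r ger0_norm.
rewrite ge0_integral_sum//; last first.
  move=> k; apply: measurableT_comp => //; exact: measurable_fun_pair.
rewrite ge0_sume_distrr; last by move=> k _; apply: integral_ge0 => w _; rewrite lee_fin.
apply: eq_bigr => k _.
rewrite (integral_independent_copy (mphi k) (phi0 k)
  (fun A B _ mB => indY k A B mB)).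
pose D := tau @^-1` [set (k : nat)].
have mD : measurable D by rewrite -[X in measurable X]setTI; exact: measurable_funP.
have -> : (n%:R^-1)%:E = P D by rewrite tau_unif.
transitivity (\int[P]_w ((\1_D w)%:E * \int[P]_w' (Y k w')%:E))%E.
  apply: eq_integral => w _.
  rewrite -ge0_integralZl//; last 2 first.
  - exact/measurable_EFinP.
  - by move=> w' _; rewrite lee_fin.
  apply: eq_integral => w' _; rewrite /phi /= ger0_norm// EFinM indicE.
  by rewrite (_ : (w \in D) = (tau w == k)) //; apply/idP/eqP; rewrite inE.
rewrite ge0_integralZr//.
- by rewrite integral_indic// setIT.
- by apply/measurable_EFinP; exact: measurable_indic.
- by apply: integral_ge0 => w _; rewrite lee_fin.
Qed.

(** * Second moments of the stochastic gradient at an iterate *)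

(** It suffices to integrate [2 m X - m^2 <= X^2], and [X] is integrable as soon
    as its square is. *)
Lemma sqr_expectation_le (R : realType) (dO : measure_display)
    (Omega : measurableType dO) (P : probability Omega R) (X : Omega -> R)
    (m : R) :
  measurable_fun [set: Omega] X ->
  (\int[P]_w (X w)%:E = m%:E -> (m ^+ 2)%:E <= \int[P]_w (X w ^+ 2)%:E)%E.
Proof.
move=> mX EX.
have mX2 : measurable_fun [set: Omega] (fun w => (X w ^+ 2)%:E).
  by apply/measurable_EFinP; exact: measurable_funX.
have [->|X2oo] := eqVneq (\int[P]_w (X w ^+ 2)%:E)%E +oo%E; first exact: leey.
have iX2 : P.-integrable [set: Omega] (fun w => (X w ^+ 2)%:E).
  apply/integrableP; split => //.
  under eq_integral do rewrite gee0_abs ?lee_fin ?sqr_ge0//.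
  by rewrite ltey.
have i1 (r : R) : P.-integrable [set: Omega] (fun=> r%:E).
  exact: finite_measure_integrable_cst.
have iX : P.-integrable [set: Omega] (fun w => (X w)%:E).
  apply: (@le_integrable _ _ _ P _ measurableT _
    (fun w => (1%:E + (X w ^+ 2)%:E)%E)) => //.
  - exact/measurable_EFinP.
  - move=> w _; rewrite /= lee_fin [leRHS]ger0_norm ?addr_ge0 ?sqr_ge0//.
    rewrite -(real_normK (num_real (X w))).
    have := sqr_ge0 (`|X w| - 1); have := sqr_ge0 `|X w|; lra.
  - exact: integrableD.
have iZ : P.-integrable [set: Omega] (fun w => ((2 * m)%:E * (X w)%:E)%E).
  exact: integrableZl.
have -> : (m ^+ 2)%:E =
    (\int[P]_w ((2 * m)%:E * (X w)%:E - (m ^+ 2)%:E))%E.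
  rewrite integralB// integralZl// EX integral_cst//.
  rewrite [X in (_ - _ * X)%E](_ : _ = 1%E); last exact: (probability_setT P).
  rewrite mule1.
  by rewrite -EFinM -EFinB; congr _%:E; ring.
apply: le_integral => //.
  exact: integrableB.
move=> w _; rewrite -EFinM -EFinB lee_fin.
have := sqr_ge0 (X w - m); lra.
Qed.

Lemma sum_integral_le (R : realType) (dO : measure_display)
    (Omega : measurableType dO) (P : probability Omega R) (n : nat)
    (Y Z : nat -> Omega -> R) (c0 c1 s : R) :
  (forall k, measurable_fun [set: Omega] (Y k)) ->
  (forall k, measurable_fun [set: Omega] (Z k)) ->
  (forall k w, 0 <= Y k w) -> (forall k w, 0 <= Z k w) ->
  0 <= c0 -> 0 <= c1 ->
  {ae P, forall w, \sum_(k < n) Y k w <= c0 + c1 * \sum_(k < n) Z k w} ->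
  (forall k, \int[P]_w (Z k w)%:E <= s%:E)%E ->
  (\sum_(k < n) \int[P]_w (Y k w)%:E <= (c0 + c1 * (n%:R * s))%:E)%E.
Proof.
move=> mY mZ Y0 Z0 c00 c10 YZ Zs.
have SZ0 w : 0 <= \sum_(k < n) Z k w by apply: sumr_ge0 => k _.
have mSZ : measurable_fun [set: Omega] (fun w => \sum_(k < n) Z k w).
  exact: measurable_sum.
have intS (V : nat -> Omega -> R) :
    (forall k, measurable_fun [set: Omega] (V k)) ->
    (forall k w, 0 <= V k w) ->
    (\int[P]_w (\sum_(k < n) V k w)%:E = \sum_(k < n) \int[P]_w (V k w)%:E)%E.
  move=> mV V0; under eq_integral do rewrite -sumEFin.
  rewrite ge0_integral_sum//; first by move=> k; exact/measurable_EFinP.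
  by move=> k w _; rewrite lee_fin.
rewrite -intS//.
apply: (@le_trans _ _ (\int[P]_w (c0 + c1 * \sum_(k < n) Z k w)%:E)%E).
  apply: ae_ge0_le_integral => //.
  - by move=> w _; rewrite lee_fin sumr_ge0.
  - by apply/measurable_EFinP; exact: measurable_sum.
  - by move=> w _; rewrite lee_fin addr_ge0// mulr_ge0.
  - by apply/measurable_EFinP; apply: measurable_funD => //; exact: measurable_funM.
  - by apply: filterS YZ => w + _; rewrite lee_fin.
under eq_integral do rewrite EFinD EFinM.
rewrite ge0_integralD//; last 2 first.
- by move=> w _; rewrite -EFinM lee_fin mulr_ge0.
- by under eq_fun do rewrite -EFinM; apply/measurable_EFinP; exact: measurable_funM.
rewrite ge0_integralZl//; last 2 first.
- exact/measurable_EFinP.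
- by move=> w _; rewrite lee_fin.
rewrite intS// integral_cst//.
rewrite [X in (_ * X + _)%E](_ : _ = 1%E); last exact: (probability_setT P).
rewrite mule1 EFinD leeD2l// EFinM lee_wpmul2l ?lee_fin//.
apply: (@le_trans _ _ (\sum_(k < n) s%:E)%E); first by apply: lee_sum.
by rewrite sumEFin sumr_const card_ord mulr_natl.
Qed.

Lemma measurable_enorm_sqr (R : realType) (d : nat) dT (T : measurableType dT)
    (h : T -> 'rV[R]_d) :
  (forall i, measurable_fun [set: T] (fun t => h t 0 i)) ->
  measurable_fun [set: T] (fun t => enorm (h t) ^+ 2).
Proof.
move=> mh; under eq_fun do rewrite enorm_sqr.
by apply: measurable_sum => i; exact: measurable_funX.
Qed.

Lemma measurable_coord (R : realType) (d : nat) dT (T : measurableType dT)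
    (h : T -> 'rV[R]_d) :
  measurable_fun [set: T] (h : T -> borel_rV R d) ->
  forall i, measurable_fun [set: T] (fun t => h t 0 i).
Proof.
move=> mh i.
apply: (measurableT_comp (f := fun u : borel_rV R d => (u : 'rV[R]_d) 0 i)) => //.
by apply: continuous_measurable_borel_rV; exact: coord_continuous.
Qed.

Section Adapted.
Context {R : realType} {d : nat} {dO dX : measure_display}.
Context {Omega : measurableType dO} {Xi : measurableType dX}.
Variable X : nat -> Omega -> Xi.
Variable g : 'rV[R]_d -> Xi -> 'rV[R]_d.
Hypothesis mg : forall i, measurable_fun [set: borel_rV R d * Xi]
  (fun z : borel_rV R d * Xi => g z.1 z.2 0 i).
Variables (a x p : nat -> Omega -> 'rV[R]_d) (x0 p0 : 'rV[R]_d) (b : R).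
Hypothesis ma : forall n (B : set (borel_rV R d)), measurable B ->
  <<s past X n.+1 >> (a n.+1 @^-1` B).
Hypothesis x_init : forall w, x 0%N w = x0.
Hypothesis p_init : forall w, p 0%N w = p0.
Hypothesis p_step : forall n w,
  p n.+1 w = p n w + b *: (g (x n w) (X n w) - p n w).
Hypothesis x_step : forall n w,
  x n.+1 w = x n w - map2_mx *%R (a n.+1 w) (p n.+1 w).

(** [past X n] involves only [X 0], ..., [X n.-1], whereas the step from [n] to
    [n.+1] uses the fresh sample [X n]; hence the shift between the index of the
    steps [a n.+1] and that of the samples. *)
Lemma adapted_iterates n :
  measurable_fun [set: g_sigma_algebraType (past X n)]
    (x n : g_sigma_algebraType (past X n) -> borel_rV R d) /\
  measurable_fun [set: g_sigma_algebraType (past X n)]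
    (p n : g_sigma_algebraType (past X n) -> borel_rV R d).
Proof.
elim: n => [|n [mx mp]].
  have -> : x 0%N = fun=> x0 by exact/funext.
  have -> : p 0%N = fun=> p0 by exact/funext.
  by split; exact: measurable_cst.
have mpS : measurable_fun [set: g_sigma_algebraType (past X n.+1)]
    (p n.+1 : g_sigma_algebraType (past X n.+1) -> borel_rV R d).
  apply: measurable_to_borel_rV => i.
  under eq_fun do rewrite p_step !mxE.
  have mpi := measurable_coord (measurable_fun_pastS mp) i.
  apply: measurable_funD => //; apply: measurable_funM => //.
  apply: measurable_funB => //.
  apply: (measurableT_comp (f := fun z : borel_rV R d * Xi => g z.1 z.2 0 i)
    (g := fun w : g_sigma_algebraType (past X n.+1) =>
      ((x n w : borel_rV R d), X n w))) => //.
  apply: measurable_fun_pair; first exact: measurable_fun_pastS.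
  exact: past_measurable_new.
split => //; apply: measurable_to_borel_rV => i.
under eq_fun do rewrite x_step !mxE.
apply: measurable_funB; first exact: measurable_coord (measurable_fun_pastS mx) i.
apply: measurable_funM; last exact: measurable_coord mpS i.
apply: measurable_coord => _ B mB; rewrite setTI; exact: ma.
Qed.

End Adapted.

Section IndependentGradient.
Context {R : realType} {d : nat} {dO dX : measure_display}.
Context {Omega : measurableType dO} {Xi : measurableType dX}.
Variable P : probability Omega R.
Variables (g : 'rV[R]_d -> Xi -> 'rV[R]_d) (G : 'rV[R]_d -> 'rV[R]_d).
Hypothesis mg : forall i, measurable_fun [set: borel_rV R d * Xi]
  (fun z : borel_rV R d * Xi => g z.1 z.2 0 i).
Hypothesis cG : continuous G.
Variables (X : {mfun Omega >-> borel_rV R d}) (Y Y' : {mfun Omega >-> Xi}).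
Hypothesis indXY : forall A B, measurable A -> measurable B ->
  (P (X @^-1` A `&` Y @^-1` B) = P (X @^-1` A) * P (Y' @^-1` B))%E.

Lemma measurable_coord_continuous i :
  measurable_fun [set: borel_rV R d]
    (fun u : borel_rV R d => G (u : 'rV[R]_d) 0 i).
Proof.
apply: continuous_measurable_borel_rV => u.
apply: (@continuous_comp _ _ _ G (fun v : 'rV[R]_d => v 0 i)); first exact: cG.
exact: coord_continuous.
Qed.

(** Freezing [X], the inner integral is at most [s] at every point. *)
Lemma integral_noise_le (s : R) :
  (forall u, \int[P]_w (enorm (g u (Y' w) - G u) ^+ 2)%:E <= s%:E)%E ->
  (\int[P]_w (enorm (g (X w) (Y w) - G (X w)) ^+ 2)%:E <= s%:E)%E.
Proof.
move=> gs.
pose phi (z : borel_rV R d * Xi) : \bar R := (enorm (g z.1 z.2 - G z.1) ^+ 2)%:E.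
have mphi : measurable_fun [set: borel_rV R d * Xi] phi.
  apply/measurable_EFinP; apply: measurable_enorm_sqr => i.
  under eq_fun do rewrite !mxE.
  apply: measurable_funB => //.
  apply: (measurableT_comp (f := fun u : borel_rV R d => G (u : 'rV[R]_d) 0 i)) => //.
  exact: measurable_coord_continuous.
have phi0 z : (0 <= phi z)%E by rewrite lee_fin sqr_ge0.
rewrite (integral_independent_copy mphi phi0 indXY).
apply: (@le_trans _ _ (\int[P]_w s%:E)%E).
  apply: ge0_le_integral => //.
  - by move=> w _; exact: integral_ge0.
  - exact: measurableT_comp (measurable_integral_copy P Y' mphi phi0) _.
  - by move=> w _; exact: gs.
rewrite integral_cst// [X in (_ * X)%E](_ : _ = 1%E) ?mule1//.
exact: probability_setT.
Qed.

(** Freezing [X], this is the inequality [(E Z)^2 <= E Z^2] in each coordinate. *)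
Lemma integral_mean_gradient_le :
  (forall u i, \int[P]_w (g u (Y' w) 0 i)%:E = (G u 0 i)%:E)%E ->
  (\int[P]_w (enorm (G (X w)) ^+ 2)%:E <=
   \int[P]_w (enorm (g (X w) (Y w)) ^+ 2)%:E)%E.
Proof.
move=> gG.
pose phi (z : borel_rV R d * Xi) : \bar R := (enorm (g z.1 z.2) ^+ 2)%:E.
have mphi : measurable_fun [set: borel_rV R d * Xi] phi.
  by apply/measurable_EFinP; exact: measurable_enorm_sqr.
have phi0 z : (0 <= phi z)%E by rewrite lee_fin sqr_ge0.
have mgY u i : measurable_fun [set: Omega] (fun w => g u (Y' w) 0 i).
  apply: (measurableT_comp (f := fun z : borel_rV R d * Xi => g z.1 z.2 0 i)
    (g := fun w => ((u : borel_rV R d), Y' w))) => //.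
  exact: measurable_fun_pair.
rewrite (integral_independent_copy mphi phi0 indXY).
apply: ge0_le_integral => //.
- by move=> w _; rewrite lee_fin sqr_ge0.
- apply/measurable_EFinP; apply: measurable_enorm_sqr => i.
  apply: (measurableT_comp (f := fun u : borel_rV R d => G (u : 'rV[R]_d) 0 i)) => //.
  exact: measurable_coord_continuous.
- exact: measurableT_comp (measurable_integral_copy P Y' mphi phi0) _.
move=> w _; rewrite /phi/= enorm_sqr -sumEFin.
under [leRHS]eq_integral do rewrite enorm_sqr -sumEFin.
rewrite ge0_integral_sum//; last 2 first.
- by move=> i; apply/measurable_EFinP; apply: measurable_funX; exact: mgY.
- by move=> i w' _; rewrite lee_fin sqr_ge0.
apply: lee_sum => i _; apply: sqr_expectation_le; first exact: mgY.
exact: gG.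
Qed.

End IndependentGradient.

(** * Convergence in expectation *)

Theorem theorem3 (R : realType) (d : nat)
  (dO dX : measure_display)
  (Omega : measurableType dO) (P : probability Omega R)
  (Xi : measurableType dX)
  (* stochastic objective; xi_ k is relevant for k >= 1 only *)
  (f : 'rV[R]_d -> Xi -> R)
  (xi : {mfun Omega >-> Xi}) (xi_ : nat -> {mfun Omega >-> Xi})
  (f_meas : measurable_fun [set: borel_rV R d * Xi]
     (fun z : borel_rV R d * Xi => f z.1 z.2))
  (xi_law : forall k (A : set Xi), (0 < k)%N -> measurable A ->
     distribution P (xi_ k) A = distribution P xi A)
  (xi_indep : mutually_independent P (fun k => xi_ k.+1 : Omega -> Xi))
  (f_int : forall x : 'rV[R]_d,
     P.-integrable [set: Omega] (fun w => (f x (xi w))%:E))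
  (f_diff : forall (z : Xi) (x : 'rV[R]_d), differentiable (f^~ z) x)
  (* expected objective *)
  (F : 'rV[R]_d -> R)
  (F_def : forall x : 'rV[R]_d, ('E_P[fun w => (f x (xi w))%R])%E = (F x)%:E)
  (F_diff : forall x : 'rV[R]_d, differentiable F x)
  (F_C1 : continuous (gradient F))
  (L : R) (L_gt0 : 0 < L)
  (F_smooth : forall x y : 'rV[R]_d,
     enorm (gradient F x - gradient F y) <= L * enorm (x - y))
  (F_bounded : has_lbound (range F))
  (sigma : R)
  (grad_unbiased : forall (x : 'rV[R]_d) (i : 'I_d),
     ('E_P[fun w => (gradient (f^~ (xi w)) x 0 i)%R])%E = (gradient F x 0 i)%:E)
  (grad_var : forall x : 'rV[R]_d,
     ('E_P[fun w => (enorm (gradient (f^~ (xi w)) x - gradient F x) ^+ 2)%R]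
      <= (sigma ^+ 2)%:E)%E)
  (* step sizes *)
  (a : nat -> Omega -> 'rV[R]_d) (a0 : 'rV[R]_d)
  (a_init : forall w, a 0%N w = a0)
  (a_adapted : forall n (B : set (borel_rV R d)), measurable B ->
     g_sigma_preimage (fun k : 'I_n.+1 => xi_ k.+1 : Omega -> Xi)
       (a n.+1 @^-1` B))
  (a_gt0 : forall n, {ae P, forall w, vlt 0 (a n w)})
  (* iterates *)
  (b : R) (b_gt0 : 0 < b)
  (x p : nat -> Omega -> 'rV[R]_d) (x0 p0 : 'rV[R]_d)
  (x_init : forall w, x 0%N w = x0)
  (p_init : forall w, p 0%N w = p0)
  (p_step : forall n w,
     p n.+1 w = p n w + b *: (gradient (f^~ (xi_ n.+1 w)) (x n w) - p n w))
  (x_step : forall n w,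
     x n.+1 w = x n w - map2_mx *%R (a n.+1 w) (p n.+1 w))
  (* parameters *)
  (alpha : R) (alpha_gt0 : 0 < alpha)
  (a_decr : forall n, {ae P, forall w, vle (a n.+1 w) (alpha^-1 *: a n w)})
  (b_lo : 1 - alpha < b) (b_hi : b <= 1)
  (eps : R) (eps_gt0 : 0 < eps)
  (abar_ge0 : 0 <= step_bound L b alpha eps)
  (delta : R) (delta_gt0 : 0 < delta)
  (a_bounds : forall n, {ae P, forall w,
     vle (const_mx delta) (a n.+1 w) /\
     vle (a n.+1 w)
       (vmin (const_mx (step_bound L b alpha eps)) (alpha^-1 *: a n w))})
  (* random iterate *)
  (n : nat) (n_ge1 : (1 <= n)%N)
  (tau : {mfun Omega >-> nat})
  (tau_unif : uniform_below P n tau)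
  (tau_indep : independent_of P tau
     (sigma_seq (fun k => xi_ k.+1 : Omega -> Xi))) :
  let H0 := F x0 + (2 * b)^-1 * dotv a0 (vsqr p0) in
  ('E_P[fun w => (enorm (gradient F (x (tau w) w)) ^+ 2)%R]
   <= (4 / (n%:R * b ^+ 2)
         * ((H0 - inf (range F)) / (delta * eps) + enorm p0 ^+ 2)
       + 4 * step_bound L b alpha eps / (delta * eps * b ^+ 2)
         * sigma ^+ 2)%:E)%E.
Proof.
cbv zeta; set H0 := F x0 + (2 * b)^-1 * dotv a0 (vsqr p0).
pose X k : Omega -> Xi := xi_ k.+1.
pose g (u : 'rV[R]_d) (z : Xi) := gradient (f^~ z) u.
pose G := gradient F.
pose A := step_bound L b alpha eps.
have mX k : measurable_fun [set: Omega] (X k) by exact: measurable_funP.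
have mg i : measurable_fun [set: borel_rV R d * Xi]
    (fun z : borel_rV R d * Xi => g z.1 z.2 0 i).
  exact: measurable_gradient.
have adapted := adapted_iterates mg (X := X) a_adapted x_init p_init p_step x_step.
have mx k : measurable_fun [set: Omega] (x k : Omega -> borel_rV R d).
  exact: (measurable_fun_past mX (adapted k).1).
pose xk k : {mfun Omega >-> borel_rV R d} := mfun_Sub (mem_set (mx k)).
have ind k B C : measurable B -> measurable C ->
    (P (xk k @^-1` B `&` X k @^-1` C) = P (xk k @^-1` B) * P (xi @^-1` C))%E.
  move=> mB mC; rewrite past_independent_new//.
    by congr (_ * _)%E; exact: xi_law.
  by have := (adapted k).1 measurableT B mB; rewrite setTI.
have noise k : (\int[P]_w (enorm (g (x k w) (X k w) - G (x k w)) ^+ 2)%:E <=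
    (sigma ^+ 2)%:E)%E.
  apply: (integral_noise_le mg F_C1 (ind k)) => u.
  by have := grad_var u; rewrite unlock.
have mean k : (\int[P]_w (enorm (G (x k w)) ^+ 2)%:E <=
    \int[P]_w (enorm (g (x k w) (X k w)) ^+ 2)%:E)%E.
  apply: (integral_mean_gradient_le mg F_C1 (ind k)) => u i.
  by have := grad_unbiased u i; rewrite unlock.
have mG i : measurable_fun [set: borel_rV R d]
    (fun u : borel_rV R d => G (u : 'rV[R]_d) 0 i).
  exact: measurable_coord_continuous.
have mGx k i : measurable_fun [set: Omega] (fun w => G (x k w) 0 i).
  exact: (measurableT_comp (f := fun u : borel_rV R d => G (u : 'rV[R]_d) 0 i)).
have mgx k i : measurable_fun [set: Omega] (fun w => g (x k w) (X k w) 0 i).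
  apply: (measurableT_comp (f := fun z : borel_rV R d * Xi => g z.1 z.2 0 i)
    (g := fun w => ((x k w : borel_rV R d), X k w))) => //.
  exact: measurable_fun_pair.
have mYG k : measurable_fun [set: Omega] (fun w => enorm (G (x k w)) ^+ 2).
  exact: measurable_enorm_sqr.
have mYg k : measurable_fun [set: Omega]
    (fun w => enorm (g (x k w) (X k w)) ^+ 2).
  exact: measurable_enorm_sqr.
have mYe k : measurable_fun [set: Omega]
    (fun w => enorm (g (x k w) (X k w) - G (x k w)) ^+ 2).
  apply: measurable_enorm_sqr => i; under eq_fun do rewrite mxE [X in _ + X]mxE.
  exact: measurable_funB.
pose c0 := 4 / b ^+ 2 * ((H0 - inf (range F)) / (delta * eps) + enorm p0 ^+ 2).
pose c1 := 4 * A / (delta * eps * b ^+ 2).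
(* [a 0] is deterministic, so its almost sure positivity is a plain fact. *)
have a0_ge0 i : 0 <= a0 0 i.
  have [N [_ PN0 aN]] := a_gt0 0%N.
  rewrite leNgt; apply/negP => a0_lt0; have NT : N = setT.
    apply/seteqP; split => // w _; apply: aN => /= /(_ i).
    by rewrite a_init mxE => /lt_trans /(_ a0_lt0); rewrite ltxx.
  by have /eqP := probability_setT P; rewrite -NT PN0 eqe eq_sym oner_eq0.
have H0_ge : inf (range F) <= H0.
  apply: (@le_trans _ _ (F x0)); first by apply: ge_inf => //; exists x0.
  rewrite lerDl; apply: mulr_ge0; first by rewrite invr_ge0 mulr_ge0 ?ltW.
  by apply: sumr_ge0 => i _; rewrite mxE; apply: mulr_ge0; rewrite ?sqr_ge0.
have de0 : 0 < delta * eps by exact: mulr_gt0.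
have b20 : 0 < b ^+ 2 by exact: exprn_gt0.
have c0_ge0 : 0 <= c0.
  apply: mulr_ge0; first by rewrite divr_ge0 ?ltW.
  apply: addr_ge0; last exact: sqr_ge0.
  by apply: divr_ge0; [rewrite subr_ge0|exact: ltW].
have c1_ge0 : 0 <= c1.
  by apply: divr_ge0; apply: mulr_ge0 => //; exact: ltW.
have pathwise : {ae P, forall w,
    \sum_(k < n) enorm (g (x k w) (X k w)) ^+ 2 <=
    c0 + c1 * \sum_(k < n) enorm (g (x k w) (X k w) - G (x k w)) ^+ 2}.
  have a_pos := ae_foralln (P := fun k w => vlt 0 (a k w)) a_gt0.
  have a_bnd := ae_foralln (P := fun k w => vle (const_mx delta) (a k.+1 w) /\
    vle (a k.+1 w) (vmin (const_mx A) (alpha^-1 *: a k w))) a_bounds.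
  apply: filterS2 a_pos a_bnd => w a_pos a_bnd.
  have := @sum_sqr_gradient_le R d F L b alpha eps delta (fun k => x k w)
    (fun k => a k w) (fun k => p k w) (fun k => g (x k w) (X k w))
    F_diff F_smooth F_bounded L_gt0 b_gt0 b_hi alpha_gt0 eps_gt0 delta_gt0.
  rewrite x_init p_init a_init; apply => //.
  - by move=> k i; have := a_pos k i; rewrite mxE; exact: ltW.
  - by move=> k i; have := (a_bnd k).1 i; rewrite mxE.
  - move=> k i; have := (a_bnd k).2 i; rewrite !mxE => /le_trans; apply.
    by rewrite ge_min lexx.
  - move=> k i; have := (a_bnd k).2 i; rewrite !mxE => /le_trans; apply.
    by rewrite ge_min lexx orbT.
have sum_bound : (\sum_(k < n) \int[P]_w (enorm (G (x k w)) ^+ 2)%:E <=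
    (c0 + c1 * (n%:R * sigma ^+ 2))%:E)%E.
  apply: (@le_trans _ _
      (\sum_(k < n) \int[P]_w (enorm (g (x k w) (X k w)) ^+ 2)%:E)%E).
    by apply: lee_sum => k _.
  apply: (sum_integral_le (Y := fun k w => enorm (g (x k w) (X k w)) ^+ 2)
    (Z := fun k w => enorm (g (x k w) (X k w) - G (x k w)) ^+ 2)) => //.
  - by move=> k w; exact: sqr_ge0.
  - by move=> k w; exact: sqr_ge0.
rewrite unlock.
pose Y k : {mfun Omega >-> R} := mfun_Sub (mem_set (mYG k)).
have Y_tau : (\int[P]_w (Y (tau w) w)%:E =
    (n%:R^-1)%:E * \sum_(k < n) \int[P]_w (Y k w)%:E)%E.
  apply: integral_uniform_time => //; first by move=> k w; exact: sqr_ge0.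
  move=> k B C mC; apply: tau_indep; apply: (@past_sigma_seq _ _ _ _ X k).
  rewrite -[_ @^-1` C]setTI.
  suff : measurable_fun [set: g_sigma_algebraType (past X k)]
      (fun w => enorm (G (x k w)) ^+ 2) by exact.
  apply: measurable_enorm_sqr => i.
  apply: (measurableT_comp (f := fun u : borel_rV R d => G (u : 'rV[R]_d) 0 i)) => //.
  exact: (adapted k).1.
rewrite [leLHS]Y_tau.
apply: (@le_trans _ _ ((n%:R^-1)%:E * (c0 + c1 * (n%:R * sigma ^+ 2))%:E)%E).
  by rewrite lee_wpmul2l// lee_fin invr_ge0.
rewrite -EFinM lee_fin /c0 /c1 -/A.
rewrite le_eqVlt; apply/orP; left; apply/eqP; field.
by rewrite !gt_eqF ?ltr0n.
Qed.
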